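(* Let $(H,\beta)$ be a cotriangular Hopf algebra over a field $k$ with $H$ commutative and cocommutative, and let $(\mathcal{A},\mathcal{H})$ be a matched pair of $(H,\beta)$-Lie algebras with actions $\triangleright:\mathcal{H}\otimes\mathcal{A}\to\mathcal{A}$ and $\triangleleft:\mathcal{H}\otimes\mathcal{A}\to\mathcal{H}$. Then the double cross sum $\mathcal{A}\bowtie\mathcal{H}$, which is $\mathcal{A}\oplus\mathcal{H}$ as a vector space (with the direct sum $H$-coaction), equipped with the bracket $$[a\oplus h,\, b\oplus g]=\bigl([a,b]+h\triangleright b-\beta(a_{(-1)},g_{(-1)})\,g_{(0)}\triangleright a_{(0)}\bigr)\oplus\bigl([h,g]+h\triangleleft b-\beta(a_{(-1)},g_{(-1)})\,g_{(0)}\triangleleft a_{(0)}\bigr)$$ for $a,b\in\mathcal{A}$, $h,g\in\mathcal{H}$, is an $(H,\beta)$-Lie algebra.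
   Context: Notation: everything is over a field $k$. For a Hopf algebra $H$ write $\Delta(h)=h_1\otimes h_2$ (summation suppressed), with counit $\varepsilon$; for a left $H$-comodule $V$ write the coaction as $\rho(v)=v_{(-1)}\otimes v_{(0)}\in H\otimes V$. Tensor products of comodules carry the coaction $v\otimes w\mapsto v_{(-1)}w_{(-1)}\otimes v_{(0)}\otimes w_{(0)}$. The Hopf algebra $H$ is not to be confused with the Lie algebra $\mathcal{H}$. Cotriangular Hopf algebra: a pair $(H,\beta)$ with $H$ a Hopf algebra and $\beta:H\otimes H\to k$ a convolution-invertible bilinear map such that for all $h,g,l\in H$: (CT1) $\beta(h_1,g_1)g_2h_2=\beta(h_2,g_2)h_1g_1$; (CT2) $\beta(h,gl)=\beta(h_1,g)\beta(h_2,l)$; (CT3) $\beta(hg,l)=\beta(g,l_1)\beta(h,l_2)$; (CT4) $\beta(h_1,g_1)\beta(g_2,h_2)=\varepsilon(g)\varepsilon(h)$. $(H,\beta)$-Lie algebra: a left $H$-comodule $\mathcal{L}$ with an $H$-comodule morphism $[\,,]:\mathcal{L}\otimes\mathcal{L}\to\mathcal{L}$ such that for all $a,b,c\in\mathcal{L}$: (1) $[a,b]=-\beta(a_{(-1)},b_{(-1)})[b_{(0)},a_{(0)}]$; (2) $[[a,b],c]+\beta(a_{(-1)},b_{(-1)}c_{(-1)})[[b_{(0)},c_{(0)}],a_{(0)}]+\beta(a_{(-1)}b_{(-1)},c_{(-1)})[[c_{(0)},a_{(0)}],b_{(0)}]=0$. Modules: all action maps are required to be $H$-comodule maps, e.g.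 $\rho(h\triangleright a)=h_{(-1)}a_{(-1)}\otimes h_{(0)}\triangleright a_{(0)}$. Let $\mathcal{A},\mathcal{H}$ be $(H,\beta)$-Lie algebras. $\mathcal{A}$ is a left $\mathcal{H}$-module via $\triangleright:\mathcal{H}\otimes\mathcal{A}\to\mathcal{A}$ if $[h,g]\triangleright a=h\triangleright(g\triangleright a)-\beta(h_{(-1)},g_{(-1)})\,g_{(0)}\triangleright(h_{(0)}\triangleright a)$ for all $h,g\in\mathcal{H}$, $a\in\mathcal{A}$. $\mathcal{H}$ is a right $\mathcal{A}$-module via $\triangleleft:\mathcal{H}\otimes\mathcal{A}\to\mathcal{H}$ if $h\triangleleft[a,b]=(h\triangleleft a)\triangleleft b-\beta(a_{(-1)},b_{(-1)})(h\triangleleft b_{(0)})\triangleleft a_{(0)}$ for all $h\in\mathcal{H}$, $a,b\in\mathcal{A}$. Matched pair of $(H,\beta)$-Lie algebras: a pair $(\mathcal{A},\mathcal{H})$ of $(H,\beta)$-Lie algebras such that $\mathcal{A}$ is a left $\mathcal{H}$-module via $\triangleright$, $\mathcal{H}$ is a right $\mathcal{A}$-module via $\triangleleft$, and for all $a,b\in\mathcal{A}$, $h,g\in\mathcal{H}$: (BB1) $h\triangleright[a,b]=[h\triangleright a,b]+\beta(h_{(-1)},a_{(-1)})[a_{(0)},h_{(0)}\triangleright b]+(h\triangleleft a)\triangleright b-\beta(a_{(-1)},b_{(-1)})(h\triangleleft b_{(0)})\triangleright a_{(0)}$; (BB2) $[h,g]\triangleleft a=[h,g\triangleleft a]+\beta(g_{(-1)},a_{(-1)})[h\triangleleft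 a_{(0)},g_{(0)}]+h\triangleleft(g\triangleright a)-\beta(h_{(-1)},g_{(-1)})\,g_{(0)}\triangleleft(h_{(0)}\triangleright a)$. *)

(* Defs.v *)
From HB Require Import structures.
From mathcomp Require Import all_boot all_algebra.
From mathcomp Require Import generic_quotient sesquilinear boolp.

Set Implicit Arguments.
Unset Strict Implicit.
Unset Printing Implicit Defensive.

Import GRing.Theory.
Local Open Scope ring_scope.
Local Open Scope quotient_scope.

(* The tensor product V ⊗ W over k.  A finite sum of pure tensors is encoded  *)
(* by the list of its terms, and V ⊗ W is the quotient of such lists by the   *)
(* congruence generated by the bilinearity relations.  No separate scalars    *)
(* are needed because c (v ⊗ w) = (c v) ⊗ w.                                  *)
Section Tensor.
Variables (k : fieldType) (V W : lmodType k).

Inductive tensor_rel : seq (V * W) -> seq (V * W) -> Prop :=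
| TensorRefl s : tensor_rel s s
| TensorSym s t : tensor_rel s t -> tensor_rel t s
| TensorTrans s t u : tensor_rel s t -> tensor_rel t u -> tensor_rel s u
| TensorCat s s' t t' :
    tensor_rel s s' -> tensor_rel t t' -> tensor_rel (s ++ t) (s' ++ t')
| TensorCatC s t : tensor_rel (s ++ t) (t ++ s)
| Tensor0 w : tensor_rel [:: (0, w)] [::]
| TensorDl v v' w : tensor_rel [:: (v + v', w)] [:: (v, w); (v', w)]
| TensorDr v w w' : tensor_rel [:: (v, w + w')] [:: (v, w); (v, w')]
| TensorZ c v w : tensor_rel [:: (c *: v, w)] [:: (v, c *: w)].

Definition tensor_relb (s t : seq (V * W)) : bool := `[< tensor_rel s t >].

Lemma tensor_relb_equiv : equiv_class_of tensor_relb.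
Proof.
split=> [s|s t|t s u].
- by apply/asboolP/TensorRefl.
- by apply/asboolP/asboolP; apply: TensorSym.
- by move=> /asboolP st /asboolP tu; apply/asboolP; apply: TensorTrans tu.
Qed.

Canonical tensor_equiv := EquivRelPack tensor_relb_equiv.
Canonical tensor_equiv_direct := defaultEncModRel tensor_relb.

Definition tensor := {eq_quot tensor_equiv}.
HB.instance Definition _ : EqQuotient _ tensor_equiv tensor :=
  EqQuotient.on tensor.
HB.instance Definition _ := Choice.on tensor.

Lemma tensor_eqP (s t : seq (V * W)) :
  (\pi_tensor s = \pi_tensor t) <-> tensor_rel s t.
Proof.
split=> [/eqP|st]; first by rewrite eqmodE => /asboolP.
by apply/eqP; rewrite eqmodE; apply/asboolP.
Qed.

Lemma repr_tensor (s : seq (V * W)) : tensor_rel (repr (\pi_tensor s)) s.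
Proof. by apply/tensor_eqP; rewrite reprK. Qed.

Definition tensor_add (x y : tensor) : tensor := \pi_tensor (repr x ++ repr y).
Definition tensor_scale (c : k) (x : tensor) : tensor :=
  \pi_tensor [seq (c *: p.1, p.2) | p <- repr x].

Lemma tensor_rel_scale c s t : tensor_rel s t ->
  tensor_rel [seq (c *: p.1, p.2) | p <- s] [seq (c *: p.1, p.2) | p <- t].
Proof.
elim=> {s t} /=.
- by move=> s; apply: TensorRefl.
- by move=> s t _; apply: TensorSym.
- by move=> s t u _ st _; apply: TensorTrans.
- by move=> s s' t t' _ ss' _ tt'; rewrite !map_cat; apply: TensorCat.
- by move=> s t; rewrite !map_cat; apply: TensorCatC.
- by move=> w; rewrite scaler0; apply: Tensor0.
- by move=> v v' w; rewrite scalerDr; apply: TensorDl.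
- by move=> v w w'; apply: TensorDr.
- move=> d v w; rewrite scalerA mulrC -scalerA.
  exact: TensorZ.
Qed.

Lemma pi_tensor_add s t :
  tensor_add (\pi_tensor s) (\pi_tensor t) = \pi_tensor (s ++ t).
Proof. by apply/tensor_eqP; apply: TensorCat; apply: repr_tensor. Qed.

Lemma pi_tensor_scale c s :
  tensor_scale c (\pi_tensor s) = \pi_tensor [seq (c *: p.1, p.2) | p <- s].
Proof. by apply/tensor_eqP; apply: tensor_rel_scale; apply: repr_tensor. Qed.

Lemma tensor_ind (P : tensor -> Prop) :
  (forall s, P (\pi_tensor s)) -> forall x, P x.
Proof. by move=> Ppi x; rewrite -[x]reprK. Qed.

Lemma tensor_addA : associative tensor_add.
Proof.
elim/tensor_ind=> s; elim/tensor_ind=> t; elim/tensor_ind=> u.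
by rewrite !pi_tensor_add catA.
Qed.

Lemma tensor_addC : commutative tensor_add.
Proof.
elim/tensor_ind=> s; elim/tensor_ind=> t; rewrite !pi_tensor_add.
by apply/tensor_eqP; apply: TensorCatC.
Qed.

Lemma tensor_add0 : left_id (\pi_tensor [::]) tensor_add.
Proof. by elim/tensor_ind=> s; rewrite pi_tensor_add. Qed.

Lemma tensor_scaleDl (x : tensor) (c d : k) :
  tensor_scale (c + d) x = tensor_add (tensor_scale c x) (tensor_scale d x).
Proof.
elim/tensor_ind: x => s; rewrite !pi_tensor_scale pi_tensor_add.
apply/tensor_eqP; elim: s => [|[v w] s IHs] /=; first exact: TensorRefl.
have: tensor_rel ([:: (c *: v, w); (d *: v, w)] ++
    ([seq (c *: p.1, p.2) | p <- s] ++ [seq (d *: p.1, p.2) | p <- s]))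
   ((c *: v, w) :: [seq (c *: p.1, p.2) | p <- s]
      ++ (d *: v, w) :: [seq (d *: p.1, p.2) | p <- s]).
  apply: (@TensorCat [:: _] [:: _]); first exact: TensorRefl.
  rewrite -cat_rcons -cats1 -cat_cons; apply: TensorCat; last exact: TensorRefl.
  exact: (TensorCatC [:: _]).
apply: TensorTrans; rewrite scalerDl -[(_, _) :: map _ _]cat1s.
by apply: TensorCat => //; apply: TensorDl.
Qed.

Lemma tensor_scale0 (x : tensor) : tensor_scale 0 x = \pi_tensor [::].
Proof.
elim/tensor_ind: x => s; rewrite pi_tensor_scale; apply/tensor_eqP.
elim: s => [|[v w] s IHs] /=; first exact: TensorRefl.
rewrite scale0r -cat1s -[X in tensor_rel _ X]cats0.
by apply: TensorCat => //; apply: Tensor0.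
Qed.

Lemma tensor_scale1 : left_id 1 tensor_scale.
Proof.
elim/tensor_ind=> s; rewrite pi_tensor_scale; congr (\pi_tensor _).
by rewrite -[RHS]map_id; apply: eq_map => -[v w] /=; rewrite scale1r.
Qed.

Lemma tensor_addN : left_inverse (\pi_tensor [::]) (tensor_scale (-1)) tensor_add.
Proof.
move=> x; rewrite -[X in tensor_add _ X](tensor_scale1 x) -tensor_scaleDl.
by rewrite addNr tensor_scale0.
Qed.

HB.instance Definition _ := GRing.isZmodule.Build tensor
  tensor_addA tensor_addC tensor_add0 tensor_addN.

Lemma tensor_scaleA (c d : k) (x : tensor) :
  tensor_scale c (tensor_scale d x) = tensor_scale (c * d) x.
Proof.
elim/tensor_ind: x => s; rewrite !pi_tensor_scale -map_comp.
by congr (\pi_tensor _); apply: eq_map => -[v w] /=; rewrite scalerA.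
Qed.

Lemma tensor_scaleDr : right_distributive tensor_scale +%R.
Proof.
move=> c; elim/tensor_ind=> s; elim/tensor_ind=> t.
rewrite -[X in tensor_scale c X]/(tensor_add _ _) -[RHS]/(tensor_add _ _).
by rewrite pi_tensor_add !pi_tensor_scale pi_tensor_add map_cat.
Qed.

HB.instance Definition _ := GRing.Zmodule_isLmodule.Build k tensor
  tensor_scaleA tensor_scale1 tensor_scaleDr
  (fun x c d => tensor_scaleDl x c d).

Definition tens (v : V) (w : W) : tensor := \pi_tensor [:: (v, w)].

(* tlift f t is the value at t of the linear map V ⊗ W -> U induced by f.  It *)
(* is written with a chosen decomposition of t into pure tensors; for         *)
(* bilinear f, the only case of use, tlift_tens and tlift_linear show that    *)
(* the choice does not matter.                                                *)
Definition tlift (U : nmodType) (f : V -> W -> U) (t : tensor) : U :=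
  \sum_(p <- repr t) f p.1 p.2.

Lemma tens_bilinear : bilinear_for *:%R *:%R tens.
Proof.
split=> [w c v v'|v c w w'] /=.
- rewrite -[RHS]/(tensor_add (tensor_scale c _) _).
  by rewrite pi_tensor_scale pi_tensor_add; apply/tensor_eqP/TensorDl.
- rewrite -[RHS]/(tensor_add (tensor_scale c _) _).
  rewrite pi_tensor_scale pi_tensor_add; apply/tensor_eqP => /=.
  apply: TensorTrans (TensorDr _ _ _) _.
  apply: (@TensorCat [:: _] [:: _] [:: _]); last exact: TensorRefl.
  exact/TensorSym/TensorZ.
Qed.

Section Lift.
Variables (U : lmodType k) (f : V -> W -> U).
Hypothesis f_bilinear : bilinear_for *:%R *:%R f.

Lemma tensor_rel_lift s1 s2 : tensor_rel s1 s2 ->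
  \sum_(p <- s1) f p.1 p.2 = \sum_(p <- s2) f p.1 p.2.
Proof.
have [fl fr] := f_bilinear.
have f0 w : f 0 w = 0.
  by have := fl w (-1) 0 0; rewrite /= scaler0 addr0 scaleN1r addNr.
have f0r v : f v 0 = 0.
  by have := fr v (-1) 0 0; rewrite /= scaler0 addr0 scaleN1r addNr.
elim=> {s1 s2} //=.
- by move=> ? ? ? _ -> _ ->.
- by move=> ? ? ? ? _ e _ e'; rewrite !big_cat /= e e'.
- by move=> ? ?; rewrite !big_cat /= addrC.
- by move=> w; rewrite big_seq1 big_nil.
- move=> v v' w; rewrite !big_cons !big_nil !addr0 /=.
  by have := fl w 1 v v'; rewrite /= !scale1r.
- move=> v w w'; rewrite !big_cons !big_nil !addr0 /=.
  by have := fr v 1 w w'; rewrite /= !scale1r.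
- move=> c v w; rewrite !big_seq1 /=.
  have := fl w c v 0; have := fr v c w 0.
  by rewrite /= f0 f0r !addr0 => -> ->.
Qed.

Lemma tlift_tens v w : tlift f (tens v w) = f v w.
Proof.
by rewrite /tlift (tensor_rel_lift (repr_tensor _)) big_seq1.
Qed.

Lemma tlift_linear : linear (tlift f).
Proof.
move=> c; elim/tensor_ind=> s1; elim/tensor_ind=> s2.
rewrite -[X in tlift f X]/(tensor_add (tensor_scale c _) _).
rewrite pi_tensor_scale pi_tensor_add /tlift.
rewrite !(tensor_rel_lift (repr_tensor _)) big_cat /= big_map; congr (_ + _).
rewrite scaler_sumr; apply: eq_bigr => -[v w] _ /=.
have [fl _] := f_bilinear.
have f0 : f 0 w = 0.
  by have := fl w (-1) 0 0; rewrite /= scaler0 addr0 scaleN1r addNr.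
by have := fl w c v 0; rewrite /= f0 !addr0.
Qed.

End Lift.

Lemma tensor_sum_tens (t : tensor) : t = \sum_(p <- repr t) tens p.1 p.2.
Proof.
rewrite -[LHS]reprK; elim: (repr t) => [|[v w] s IHs]; first by rewrite big_nil.
rewrite big_cons -IHs -[RHS]/(tensor_add _ _).
by rewrite pi_tensor_add.
Qed.

End Tensor.

Notation "V ⊗ W" := (tensor V W)
  (at level 40, left associativity) : type_scope.
Notation "v ⊗ w" := (tens v w)
  (at level 40, left associativity) : ring_scope.

(* Sweedler notation: \sw_(x, y <- t) F is F(x, y), summed over t = x ⊗ y.    *)
Notation "\sw_ ( x , y <- t ) F" := (tlift (fun x y => F) t)
  (at level 41, x name, y name, t at level 200, F at level 41,
   right associativity,
   format "'[' \sw_ ( x ,  y  <-  t ) '/  '  F ']'") : ring_scope.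

Notation bilinear_map f := (bilinear_for *:%R *:%R f).

Record hopfAlgebra (k : fieldType) := HopfAlgebra {
  hopf_alg :> algType k;
  comul : hopf_alg -> hopf_alg ⊗ hopf_alg;
  counit : hopf_alg -> k;
  antipode : hopf_alg -> hopf_alg;
  comul_linear : linear comul;
  counit_linear : scalar counit;
  antipode_linear : linear antipode;
  comul_coassoc : forall h,
    \sw_(x, y <- comul h) \sw_(x1, x2 <- comul x) x1 ⊗ (x2 ⊗ y)
    = \sw_(x, y <- comul h) x ⊗ comul y;
  counit_left : forall h, \sw_(h1, h2 <- comul h) counit h1 *: h2 = h;
  counit_right : forall h, \sw_(h1, h2 <- comul h) counit h2 *: h1 = h;
  comul_one : comul 1 = 1 ⊗ 1;
  comul_mul : forall h g, comul (h * g) =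
    \sw_(h1, h2 <- comul h) \sw_(g1, g2 <- comul g) (h1 * g1) ⊗ (h2 * g2);
  counit_one : counit 1 = 1;
  counit_mul : forall h g, counit (h * g) = counit h * counit g;
  antipode_left : forall h,
    \sw_(h1, h2 <- comul h) antipode h1 * h2 = (counit h)%:A;
  antipode_right : forall h,
    \sw_(h1, h2 <- comul h) h1 * antipode h2 = (counit h)%:A
}.

Arguments comul {k h} _ : rename.
Arguments counit {k h} _ : rename.
Arguments antipode {k h} _ : rename.

Section HopfLie.
Variables (k : fieldType) (H : hopfAlgebra k).

Definition commutative_hopf := forall h g : H, h * g = g * h.

Definition cocommutative_hopf :=
  forall h : H, \sw_(h1, h2 <- comul h) h2 ⊗ h1 = comul h.

Definition convolution_invertible (beta : H -> H -> k) :=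
  exists2 gamma : H -> H -> k, bilinear_for *%R *%R gamma &
  forall h g : H,
    \sw_(h1, h2 <- comul h) \sw_(g1, g2 <- comul g) (beta h1 g1 * gamma h2 g2)
    = counit h * counit g /\
    \sw_(h1, h2 <- comul h) \sw_(g1, g2 <- comul g) (gamma h1 g1 * beta h2 g2)
    = counit h * counit g.

Record cotriangular (beta : H -> H -> k) : Prop := Cotriangular {
  ct_bilinear : bilinear_for *%R *%R beta;
  ct_invertible : convolution_invertible beta;
  CT1 : forall h g : H,
    \sw_(h1, h2 <- comul h) \sw_(g1, g2 <- comul g) (beta h1 g1 *: (g2 * h2))
    = \sw_(h1, h2 <- comul h) \sw_(g1, g2 <- comul g) (beta h2 g2 *: (h1 * g1));
  CT2 : forall h g l : H,
    beta h (g * l) = \sw_(h1, h2 <- comul h) (beta h1 g * beta h2 l);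
  CT3 : forall h g l : H,
    beta (h * g) l = \sw_(l1, l2 <- comul l) (beta g l1 * beta h l2);
  CT4 : forall h g : H,
    \sw_(h1, h2 <- comul h) \sw_(g1, g2 <- comul g) (beta h1 g1 * beta g2 h2)
    = counit g * counit h
}.

Record comodule (V : lmodType k) (rho : V -> H ⊗ V) : Prop := Comodule {
  coact_linear : linear rho;
  coact_coassoc : forall v,
    \sw_(x, w <- rho v) \sw_(x1, x2 <- comul x) x1 ⊗ (x2 ⊗ w)
    = \sw_(x, w <- rho v) x ⊗ rho w;
  coact_counit : forall v, \sw_(x, w <- rho v) counit x *: w = v
}.

(* A linear map V ⊗ W -> U is represented by the bilinear map f that induces  *)
(* it; V ⊗ W carries the diagonal coaction.                                   *)
Definition comodule_map2 (V W U : lmodType k) (rhoV : V -> H ⊗ V)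
    (rhoW : W -> H ⊗ W) (rhoU : U -> H ⊗ U) (f : V -> W -> U) :=
  bilinear_map f /\
  forall v w, rhoU (f v w) =
    \sw_(v1, v0 <- rhoV v) \sw_(w1, w0 <- rhoW w) (v1 * w1) ⊗ f v0 w0.

Variable beta : H -> H -> k.

(* In Sweedler sums over a coaction, a1 and a0 stand for the components       *)
(* a_(-1) in H and a_(0) of a.                                                *)
Record lie_algebra (L : lmodType k) (rho : L -> H ⊗ L)
    (br : L -> L -> L) : Prop := LieAlgebra {
  lie_comodule : comodule rho;
  lie_bracket : comodule_map2 rho rho rho br;
  lie_antisym : forall a b, br a b =
    - \sw_(a1, a0 <- rho a) \sw_(b1, b0 <- rho b) (beta a1 b1 *: br b0 a0);
  lie_jacobi : forall a b c,
    br (br a b) c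
    + \sw_(a1, a0 <- rho a) \sw_(b1, b0 <- rho b) \sw_(c1, c0 <- rho c)
        (beta a1 (b1 * c1) *: br (br b0 c0) a0)
    + \sw_(a1, a0 <- rho a) \sw_(b1, b0 <- rho b) \sw_(c1, c0 <- rho c)
        (beta (a1 * b1) c1 *: br (br c0 a0) b0) = 0
}.

Section Actions.
Variables (A L : lmodType k).
Variables (rhoA : A -> H ⊗ A) (brA : A -> A -> A).
Variables (rhoL : L -> H ⊗ L) (brL : L -> L -> L).

Definition left_module (lact : L -> A -> A) :=
  comodule_map2 rhoL rhoA rhoA lact /\
  forall h g a, lact (brL h g) a = lact h (lact g a)
    - \sw_(h1, h0 <- rhoL h) \sw_(g1, g0 <- rhoL g)
        (beta h1 g1 *: lact g0 (lact h0 a)).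

Definition right_module (ract : L -> A -> L) :=
  comodule_map2 rhoL rhoA rhoL ract /\
  forall h a b, ract h (brA a b) = ract (ract h a) b
    - \sw_(a1, a0 <- rhoA a) \sw_(b1, b0 <- rhoA b)
        (beta a1 b1 *: ract (ract h b0) a0).

Record matched_pair (lact : L -> A -> A) (ract : L -> A -> L) : Prop :=
MatchedPair {
  mp_lieA : lie_algebra rhoA brA;
  mp_lieL : lie_algebra rhoL brL;
  mp_left : left_module lact;
  mp_right : right_module ract;
  BB1 : forall h a b,
    lact h (brA a b) = brA (lact h a) b
    + \sw_(h1, h0 <- rhoL h) \sw_(a1, a0 <- rhoA a)
        (beta h1 a1 *: brA a0 (lact h0 b))
    + lact (ract h a) b
    - \sw_(a1, a0 <- rhoA a) \sw_(b1, b0 <- rhoA b)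
        (beta a1 b1 *: lact (ract h b0) a0);
  BB2 : forall h g a,
    ract (brL h g) a = brL h (ract g a)
    + \sw_(g1, g0 <- rhoL g) \sw_(a1, a0 <- rhoA a)
        (beta g1 a1 *: brL (ract h a0) g0)
    + ract h (lact g a)
    - \sw_(h1, h0 <- rhoL h) \sw_(g1, g0 <- rhoL g)
        (beta h1 g1 *: ract g0 (lact h0 a))
}.

Definition dsum_coact (x : A * L) : H ⊗ (A * L)%type :=
  \sw_(a1, a0 <- rhoA x.1) a1 ⊗ (a0, 0) + \sw_(h1, h0 <- rhoL x.2) h1 ⊗ (0, h0).

Definition dcs_bracket (lact : L -> A -> A) (ract : L -> A -> L)
    (x y : A * L) : A * L :=
  let: (a, h) := x in let: (b, g) := y in
  (brA a b + lact h b
   - \sw_(a1, a0 <- rhoA a) \sw_(g1, g0 <- rhoL g) (beta a1 g1 *: lact g0 a0),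
   brL h g + ract h b
   - \sw_(a1, a0 <- rhoA a) \sw_(g1, g0 <- rhoL g) (beta a1 g1 *: ract g0 a0)).

End Actions.

End HopfLie.

(* Main.v *)
Require Import Defs.
From mathcomp Require Import all_boot all_algebra.

Set Implicit Arguments.
Unset Strict Implicit.
Unset Printing Implicit Defensive.

Import GRing.Theory.
Local Open Scope ring_scope.

(** Left H-comodules form a symmetric monoidal category: the symmetry sends
v ⊗ w to [beta v1 w1] times w0 ⊗ v0, it is colinear by (CT1), an involution by
(CT4), and (CT2), (CT3) are the hexagon identities.  An (H, beta)-Lie algebra
is a Lie algebra in that category, so the theorem is the classical statement
that the double cross sum of a matched pair is a Lie algebra, with every
exchange of two arguments performed by the symmetry.

Everything is expressed with one operator on two-argument functions,
[braid f v w], the sum of [beta v1 w1 *: f v0 w0].  The axioms of beta enter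
through [braid_mulr] and [braid_mull] (the hexagon identities), [braidK] (the
symmetry is an involution), their consequences
[braid_cancelr] and [braid_cancell] (moving an argument past a composite f(x, z)
and then back past one of its two parts leaves the exchange with the other
part), and [colin2_braid] (composing with the symmetry preserves colinearity).

For an antisymmetric colinear bracket the Jacobi identity is equivalent to
the Leibniz rule
   [x, [y, z]] = [[x, y], z] - sum of beta(y1, z1) [[x, z0], y0],
which has the same shape as the module axioms and as the conditions (BB1) and
(BB2), and, unlike the Jacobi identity, involves no product in H
([leibniz_jacobi]).  Both x, y and y, z can be exchanged in it
([leibniz_swap12], [leibniz_swap23]).  By trilinearity it is enough to
prove it on A ⊕ L for arguments that lie in one of the two summands:
 - three arguments in the same summand: the Jacobi identity of A or of L;
 - (h, a, b) with h in L and a, b in A: its A-component is (BB1), its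
   L-component is the axiom of the right module L;
 - (h, g, a) with h, g in L and a in A: its A-component is the axiom of the left
   module A, its L-component is (BB2);
 - the other mixed cases follow from these two by exchanging arguments. *)

(** * Linear and bilinear maps, and sums over tensors *)

Section Multilinear.
Variable k : fieldType.
Implicit Types V W U X Y : lmodType k.

(** [lin], [bil] and [trilin] are plain statements about functions, without
scaling laws or bundled structures, so that a syntax-directed tactic can prove
that an expression is linear in one of its variables. *)
Definition lin V U (f : V -> U) := forall c x y, f (c *: x + y) = c *: f x + f y.

Definition bil V W U (f : V -> W -> U) :=
  (forall w, lin (fun v => f v w)) /\ (forall v, lin (f v)).

Definition trilin V W X U (f : V -> W -> X -> U) :=
  (forall v, bil (f v)) /\ (forall w x, lin (fun v => f v w x)).

Lemma bilP V W U (f : V -> W -> U) : bilinear_map f <-> bil f.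
Proof.
split=> [[fl fr]|[fl fr]]; split=> *; first [exact: fl | exact: fr].
Qed.

Section Lin.
Variables (V U : lmodType k) (f : V -> U).
Hypothesis fL : lin f.

Lemma linD x y : f (x + y) = f x + f y.
Proof. by have := fL 1 x y; rewrite !scale1r. Qed.

Lemma lin0 : f 0 = 0.
Proof. by apply: (addIr (f 0)); rewrite -linD !add0r. Qed.

Lemma linZ c x : f (c *: x) = c *: f x.
Proof. by have := fL c x 0; rewrite lin0 !addr0. Qed.

Lemma linN x : f (- x) = - f x.
Proof. by rewrite -scaleN1r linZ scaleN1r. Qed.

Lemma linB x y : f (x - y) = f x - f y.
Proof. by rewrite linD linN. Qed.

Lemma lin_sw (X Y : lmodType k) (F : X -> Y -> V) (t : X ⊗ Y) :
  f (tlift F t) = \sw_(x, y <- t) f (F x y).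
Proof. exact: (big_morph f linD lin0). Qed.

End Lin.

Lemma bil0l V W U (f : V -> W -> U) w : bil f -> f 0 w = 0.
Proof. by case=> fL _; exact: (lin0 (fL w)). Qed.

Lemma bil0r V W U (f : V -> W -> U) v : bil f -> f v 0 = 0.
Proof. by case=> _ fL; exact: (lin0 (fL v)). Qed.

Lemma eq_tlift V W (U : nmodType) (f g : V -> W -> U) (t : V ⊗ W) :
  (forall v w, f v w = g v w) -> tlift f t = tlift g t.
Proof. by move=> fg; apply: eq_bigr => p _. Qed.

Lemma tlift_add V W U (f g : V -> W -> U) (t : V ⊗ W) :
  tlift f t + tlift g t = \sw_(v, w <- t) (f v w + g v w).
Proof. by rewrite /tlift -big_split. Qed.

Lemma tlift_exchange V W X Y (U : nmodType) (f : V -> W -> X -> Y -> U)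
    (t : V ⊗ W) (s : X ⊗ Y) :
  \sw_(v, w <- t) \sw_(x, y <- s) f v w x y
  = \sw_(x, y <- s) \sw_(v, w <- t) f v w x y.
Proof. exact: exchange_big. Qed.

Lemma tlift_scale V W (r : V -> W -> k) U (u : U) (t : V ⊗ W) :
  (\sw_(v, w <- t) r v w) *: u = \sw_(v, w <- t) (r v w *: u).
Proof. exact: scaler_suml. Qed.

Lemma scale_tlift V W U c (f : V -> W -> U) (t : V ⊗ W) :
  c *: tlift f t = \sw_(v, w <- t) (c *: f v w).
Proof. exact: scaler_sumr. Qed.

Lemma lin_id V : lin (fun x : V => x).
Proof. by []. Qed.

Lemma lin_comp V U X (f : V -> U) (g : X -> V) :
  lin f -> lin g -> lin (fun x => f (g x)).
Proof. by move=> fL gL c x y; rewrite gL fL. Qed.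

Lemma lin_bill V W U X (f : V -> W -> U) (g : X -> V) w :
  bil f -> lin g -> lin (fun x => f (g x) w).
Proof. by case=> fL _ gL; apply: lin_comp (fL w) gL. Qed.

Lemma lin_bilr V W U X (f : V -> W -> U) (g : X -> W) v :
  bil f -> lin g -> lin (fun x => f v (g x)).
Proof. by case=> _ fL gL; apply: lin_comp (fL v) gL. Qed.

Lemma lin_add V U (f g : V -> U) : lin f -> lin g -> lin (fun x => f x + g x).
Proof. by move=> fL gL c x y; rewrite fL gL scalerDr addrACA. Qed.

Lemma lin_opp V U (f : V -> U) : lin f -> lin (fun x => - f x).
Proof. by move=> fL c x y; rewrite fL opprD scalerN. Qed.

Lemma lin_scale V U c (f : V -> U) : lin f -> lin (fun x => c *: f x).
Proof. by move=> fL d x y; rewrite fL scalerDr !scalerA mulrC. Qed.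

Lemma lin_scalel V U (r : V -> k) (u : U) : scalar r -> lin (fun x => r x *: u).
Proof. by move=> rL c x y; rewrite rL scalerDl scalerA. Qed.

Lemma lin_fst V U X (f : X -> V * U) : lin f -> lin (fun x => (f x).1).
Proof. by move=> fL c x y; rewrite fL. Qed.

Lemma lin_snd V U X (f : X -> V * U) : lin f -> lin (fun x => (f x).2).
Proof. by move=> fL c x y; rewrite fL. Qed.

Lemma lin_tlift V W U X (F : X -> V -> W -> U) (t : V ⊗ W) :
  (forall v w, lin (fun x => F x v w)) -> lin (fun x => tlift (F x) t).
Proof.
move=> FL c x y; rewrite /tlift scaler_sumr -big_split /=.
by apply: eq_bigr => p _; apply: FL.
Qed.

Lemma lin_sweedler V W U X (F : V -> W -> U) (g : X -> V ⊗ W) :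
  bil F -> lin g -> lin (fun x => tlift F (g x)).
Proof.
move=> FL gL c x y; rewrite gL.
by apply: tlift_linear; apply/bilP.
Qed.

Lemma sw_tens V W U (f : V -> W -> U) v w :
  bil f -> \sw_(x, y <- v ⊗ w) f x y = f v w.
Proof. by move=> fL; apply: tlift_tens; apply/bilP. Qed.

Lemma bil_tens V W : bil (@tens k V W).
Proof. exact/bilP/tens_bilinear. Qed.

Lemma bil_mul (B : algType k) : bil ( *%R : B -> B -> B).
Proof.
by split=> w c x y; [rewrite mulrDl scalerAl | rewrite mulrDr scalerAr].
Qed.

Lemma sw_sw_tens V W X Y U (F : V -> W -> U) (f : X -> Y -> V) (g : X -> Y -> W)
   (t : X ⊗ Y) : bil F ->
  \sw_(v, w <- \sw_(x, y <- t) f x y ⊗ g x y) F v w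
  = \sw_(x, y <- t) F (f x y) (g x y).
Proof.
move=> FL; rewrite (@lin_sw _ _ (tlift F)) => [|c x y].
  by apply: eq_tlift => x y; rewrite sw_tens.
by apply: tlift_linear; apply/bilP.
Qed.

End Multilinear.

(** The values of beta and of the counit lie in k and occur only as scalars, so
their linearity is used on the scaled vector. *)
Lemma bil_form_scalel (k : fieldType) (V W X U : lmodType k) (b : V -> W -> k)
    (g : X -> V) w (u : U) :
  bilinear_for *%R *%R b -> lin g -> lin (fun x => b (g x) w *: u).
Proof. by case=> bL _ gL; apply: lin_scalel => c x y; rewrite gL bL. Qed.

Lemma bil_form_scaler (k : fieldType) (V W X U : lmodType k) (b : V -> W -> k)
    (g : X -> W) v (u : U) :
  bilinear_for *%R *%R b -> lin g -> lin (fun x => b v (g x) *: u).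
Proof. by case=> _ bL gL; apply: lin_scalel => c x y; rewrite gL bL. Qed.

Lemma lin_form_scale (k : fieldType) (V X U : lmodType k) (e : V -> k)
    (g : X -> V) (u : U) :
  scalar e -> lin g -> lin (fun x => e (g x) *: u).
Proof. by move=> eL gL; apply: lin_scalel => c x y; rewrite gL; apply: eL. Qed.

(** [linear] proves goals [lin _], [bil _] and [trilin _] by recursion on the
expression under the binder; (bi)linearity of the maps that occur as heads is
taken from the context and from the hint database. *)
Create HintDb linear.
#[local] Hint Resolve bil_tens : linear.
#[local] Hint Extern 1 (bil (@GRing.mul _)) => exact: bil_mul : linear.

Ltac lin_hyp := solve [eauto with linear].

Ltac linear_step :=
  lazymatch goal with
  | |- forall _, _ => intro
  | |- trilin _ => split
  | |- bil _ => first [lin_hyp | split=> ?; cbv beta]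
  | |- lin _ => cbv beta;
    match goal with
    | |- lin (fun x => x) => exact: lin_id
    | |- lin (fun x => tlift (fun a b => @?F x a b) ?t) =>
        apply: (lin_tlift (F := F))
    | |- lin (fun x => tlift ?F (@?g x)) => apply: (lin_sweedler (F := F) (g := g))
    | |- lin (fun x => ?b (@?g x) ?w *: ?u) =>
        apply: (bil_form_scalel (b := b) (g := g)); [lin_hyp|]
    | |- lin (fun x => ?b ?v (@?g x) *: ?u) =>
        apply: (bil_form_scaler (b := b) (g := g)); [lin_hyp|]
    | |- lin (fun x => ?e (@?g x) *: ?u) =>
        apply: (lin_form_scale (e := e) (g := g)); [lin_hyp|]
    | |- lin (fun x => ?c *: @?f x) => apply: (@lin_scale _ _ _ c f)
    | |- lin (fun x => - @?f x) => apply: (lin_opp (f := f))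
    | |- lin (fun x => @?f x + @?g x) => apply: (lin_add (f := f) (g := g))
    | |- lin (fun x => (@?f x).1) => apply: (lin_fst (f := f))
    | |- lin (fun x => (@?f x).2) => apply: (lin_snd (f := f))
    | |- lin (fun x => ?f (@?g x) ?w) =>
        apply: (lin_bill (f := f) (g := g)); [lin_hyp|]
    | |- lin (fun x => ?f ?v (@?g x)) =>
        apply: (lin_bilr (f := f) (g := g)); [lin_hyp|]
    | |- lin ?f => lin_hyp
    | |- lin (fun x => ?f (@?g x)) => apply: (lin_comp (f := f) (g := g)); [lin_hyp|]
    | |- lin ?f => change (lin (fun x => f x))
    end
  end.

Ltac linear := repeat linear_step.

#[local] Hint Extern 2 (bil ?f) =>
  lazymatch f with fun _ _ => _ => split=> ?; cbv beta; linear end : linear.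

(** * Comodules and iterated coactions *)

Section Braid.
Variables (k : fieldType) (H : hopfAlgebra k) (beta : H -> H -> k).
Hypothesis ct : cotriangular beta.

Lemma beta_bil : bilinear_for *%R *%R beta.
Proof. exact: ct_bilinear ct. Qed.
Hint Resolve beta_bil : linear.

Lemma counit_scalar : scalar (@counit k H).
Proof. exact: counit_linear. Qed.
Hint Resolve counit_scalar : linear.

Lemma comul_lin : lin (@comul k H).
Proof. exact: comul_linear. Qed.
Hint Resolve comul_lin : linear.

Structure comod := Comod {
  comod_sort :> lmodType k;
  coact : comod_sort -> H ⊗ comod_sort;
  coactP : comodule coact
}.

Implicit Types V W X Y Z : comod.

Lemma coact_lin V : lin (@coact V).
Proof. exact: coact_linear (coactP V). Qed.
Hint Resolve coact_lin : linear.

(** Coassociativity of the coaction, in the form in which it is used under an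
arbitrary trilinear expression. *)
Lemma coact_iter V (U : lmodType k) (K : H -> H -> V -> U) v :
  trilin K -> \sw_(x, w <- coact v) \sw_(y, u <- coact w) K x y u
  = \sw_(x, w <- coact v) \sw_(x1, x2 <- comul x) K x1 x2 w.
Proof.
move=> [KL1 KL2].
pose f (t : tensor H (tensor H V)) := \sw_(x, s <- t) \sw_(y, w <- s) K x y w.
have KL3 x y : lin (K x y) by have [_] := KL1 x; apply.
have KL4 x w : lin ((K x)^~ w) by have [+ _] := KL1 x; apply.
have fL : lin f by rewrite /f; linear.
have := congr1 f (coact_coassoc (coactP V) v).
rewrite !(lin_sw fL) => e.
rewrite [LHS](_ : _ = \sw_(x, w <- coact v) f (x ⊗ coact w)).
  rewrite -e; apply: eq_tlift => x w; rewrite (lin_sw fL).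
  apply: eq_tlift => x1 x2; rewrite /f sw_tens; first by rewrite sw_tens.
  by linear; auto.
by apply: eq_tlift => x w; rewrite /f sw_tens //; linear; auto.
Qed.

(** The same for two elements at once, in the shape produced by two nested
exchanges of the same two arguments. *)
Lemma coact_iter2 V W (U : lmodType k) (K : H -> H -> H -> H -> V -> W -> U) v w :
  (forall y y' w, trilin (fun x x' v => K x y x' y' v w)) ->
  (forall x x' v, trilin (fun y y' w => K x y x' y' v w)) ->
  \sw_(v1, v0 <- coact v) \sw_(w1, w0 <- coact w)
    \sw_(v2, v00 <- coact v0) \sw_(w2, w00 <- coact w0) K v1 w1 v2 w2 v00 w00
  = \sw_(v1, v0 <- coact v) \sw_(w1, w0 <- coact w)
    \sw_(x, x' <- comul v1) \sw_(y, y' <- comul w1) K x y x' y' v0 w0.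
Proof.
move=> KL KR.
transitivity (\sw_(v1, v0 <- coact v) \sw_(x, x' <- comul v1)
    \sw_(w1, w0 <- coact w) \sw_(w2, w00 <- coact w0) K x w1 x' w2 v0 w00).
  rewrite -coact_iter.
    by apply: eq_tlift => v1 v0; rewrite tlift_exchange.
  split=> [x|x' v']; first split=> [v'|x'];
    apply: lin_tlift => y w'; apply: lin_tlift => y' w00;
    have [bL aL] := KL y y' w00; try have [cL dL] := bL x.
  - exact: cL.
  - exact: dL.
  - exact: aL.
apply: eq_tlift => v1 v0; rewrite [RHS]tlift_exchange; apply: eq_tlift => x x'.
by rewrite coact_iter.
Qed.

Lemma coact_counit_lin V (U : lmodType k) (g : V -> U) v :
  lin g -> \sw_(x, w <- coact v) (counit x *: g w) = g v.
Proof.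
move=> gL; rewrite -[in RHS](coact_counit (coactP V) v) (lin_sw gL).
by apply: eq_tlift => x w; rewrite (linZ gL).
Qed.

(** * The operator braid *)

Definition braid V W (U : lmodType k) (f : V -> W -> U) (v : V) (w : W) : U :=
  \sw_(v1, v0 <- coact v) \sw_(w1, w0 <- coact w) (beta v1 w1 *: f v0 w0).

Lemma bil_braid V W (U : lmodType k) (f : V -> W -> U) : bil f -> bil (braid f).
Proof. by move=> fL; rewrite /braid; linear. Qed.
Hint Resolve bil_braid : linear.

Lemma eq_braid V W (U : lmodType k) (f g : V -> W -> U) v w :
  (forall v w, f v w = g v w) -> braid f v w = braid g v w.
Proof.
by move=> fg; apply: eq_tlift => *; apply: eq_tlift => *; rewrite fg.
Qed.

Lemma lin_braid V W (U X : lmodType k) (g : U -> X) (f : V -> W -> U) v w :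
  lin g -> g (braid f v w) = braid (fun v w => g (f v w)) v w.
Proof.
move=> gL; rewrite (lin_sw gL); apply: eq_tlift => v1 v0.
by rewrite (lin_sw gL); apply: eq_tlift => w1 w0; rewrite (linZ gL).
Qed.

Lemma braidN V W (U : lmodType k) (f : V -> W -> U) v w :
  braid (fun v w => - f v w) v w = - braid f v w.
Proof. by rewrite -(lin_braid (g := -%R)) // => c x y; rewrite opprD scalerN. Qed.

Lemma braidD V W (U : lmodType k) (f g : V -> W -> U) v w :
  braid (fun v w => f v w + g v w) v w = braid f v w + braid g v w.
Proof.
rewrite /braid /tlift -big_split; apply: eq_bigr => p _.
by rewrite -big_split; apply: eq_bigr => q _; rewrite scalerDr.
Qed.

Lemma braidB V W (U : lmodType k) (f g : V -> W -> U) v w :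
  braid (fun v w => f v w - g v w) v w = braid f v w - braid g v w.
Proof. by rewrite braidD braidN. Qed.

(** The symmetry is an involution: after collecting the two coactions of each
argument, the scalar is the left-hand side of (CT4). *)
Lemma braidK V W (U : lmodType k) (f : V -> W -> U) v w : bil f ->
  braid (fun v w => braid (fun w v => f v w) w v) v w = f v w.
Proof.
move=> fL; rewrite /braid.
transitivity (\sw_(v1, v0 <- coact v) \sw_(w1, w0 <- coact w)
    \sw_(v2, v00 <- coact v0) \sw_(w2, w00 <- coact w0)
    (beta v1 w1 *: (beta w2 v2 *: f v00 w00))).
  apply: eq_tlift => v1 v0; apply: eq_tlift => w1 w0.
  rewrite tlift_exchange scale_tlift; apply: eq_tlift => w2 w00.
  by rewrite scale_tlift.
rewrite (coact_iter2 (K := fun x y x' y' v w =>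
  beta x y *: (beta y' x' *: f v w))); [|linear..].
transitivity (\sw_(v1, v0 <- coact v) \sw_(w1, w0 <- coact w)
  (counit w1 *: (counit v1 *: f v0 w0))).
  apply: eq_tlift => v1 v0; apply: eq_tlift => w1 w0.
  rewrite scalerA -(CT4 ct) tlift_scale; apply: eq_tlift => x y.
  by rewrite tlift_scale; apply: eq_tlift => x' y'; rewrite scalerA.
rewrite -[RHS](coact_counit_lin (g := f^~ w)); last by linear.
apply: eq_tlift => v1 v0; rewrite (coact_counit_lin (g := fun w => _ *: f v0 w)) //.
by linear.
Qed.

(** The hexagon identities: by (CT2) and (CT3), a product inside beta splits
into two successive exchanges. *)
Lemma braid_mulr X Y Z (U : lmodType k) (T : X -> Y -> Z -> U) x y z :
  trilin T ->
  \sw_(x1, x0 <- coact x) \sw_(y1, y0 <- coact y) \sw_(z1, z0 <- coact z)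
    (beta x1 (y1 * z1) *: T x0 y0 z0)
  = braid (fun x y => braid (fun x z => T x y z) x z) x y.
Proof.
move=> [T1 T2]; have T3 x0 y0 : lin (T x0 y0) by case: (T1 x0).
have T4 x0 z0 : lin (fun y => T x0 y z0) by case: (T1 x0).
rewrite /braid.
transitivity (\sw_(x1, x0 <- coact x) \sw_(a, b <- comul x1)
  \sw_(y1, y0 <- coact y) \sw_(z1, z0 <- coact z)
    (beta a y1 *: (beta b z1 *: T x0 y0 z0))).
  apply: eq_tlift => x1 x0; rewrite [RHS]tlift_exchange.
  apply: eq_tlift => y1 y0; rewrite [RHS]tlift_exchange; apply: eq_tlift => z1 z0.
  by rewrite (CT2 ct) tlift_scale; apply: eq_tlift => *; rewrite scalerA.
rewrite -coact_iter; [|linear..].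
apply: eq_tlift => x1 x0; rewrite tlift_exchange; apply: eq_tlift => y1 y0.
by rewrite scale_tlift; apply: eq_tlift => *; rewrite scale_tlift.
Qed.

Lemma braid_mull X Y Z (U : lmodType k) (T : X -> Y -> Z -> U) x y z :
  trilin T ->
  \sw_(x1, x0 <- coact x) \sw_(y1, y0 <- coact y) \sw_(z1, z0 <- coact z)
    (beta (x1 * y1) z1 *: T x0 y0 z0)
  = braid (fun y z => braid (fun x z => T x y z) x z) y z.
Proof.
move=> [T1 T2]; have T3 x0 y0 : lin (T x0 y0) by case: (T1 x0).
have T4 x0 z0 : lin (fun y => T x0 y z0) by case: (T1 x0).
rewrite /braid tlift_exchange.
apply: eq_tlift => y1 y0.
transitivity (\sw_(z1, z0 <- coact z) \sw_(a, b <- comul z1)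
  \sw_(x1, x0 <- coact x) (beta y1 a *: (beta x1 b *: T x0 y0 z0))).
  rewrite tlift_exchange; apply: eq_tlift => z1 z0.
  rewrite tlift_exchange; apply: eq_tlift => x1 x0.
  by rewrite (CT3 ct) tlift_scale; apply: eq_tlift => *; rewrite scalerA.
rewrite -coact_iter; [|linear..].
apply: eq_tlift => z1 z0; rewrite scale_tlift tlift_exchange.
by apply: eq_tlift => x1 x0; rewrite scale_tlift.
Qed.

(** * Colinear maps and the symmetry *)

Definition colin2 V W X (f : V -> W -> X) :=
  comodule_map2 (@coact V) (@coact W) (@coact X) f.

Definition colin V W (i : V -> W) :=
  lin i /\ forall v, coact (i v) = \sw_(x, v0 <- coact v) x ⊗ i v0.

Lemma bil_colin2 V W X (f : V -> W -> X) : colin2 f -> bil f.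
Proof. by case=> /bilP. Qed.
Hint Resolve bil_colin2 : linear.

Lemma lin_colin V W (i : V -> W) : colin i -> lin i.
Proof. by case. Qed.
Hint Resolve lin_colin : linear.

Lemma sw_colin2 V W X (f : V -> W -> X) (U : lmodType k) (K : H -> X -> U) v w :
  colin2 f -> bil K -> \sw_(x, u <- coact (f v w)) K x u
  = \sw_(v1, v0 <- coact v) \sw_(w1, w0 <- coact w) K (v1 * w1) (f v0 w0).
Proof.
move=> [fL fE] KL; have KLl: lin (tlift K) by linear.
rewrite fE (lin_sw KLl); apply: eq_tlift => v1 v0.
by rewrite sw_sw_tens.
Qed.

Lemma sw_intertwiner V (W U : lmodType k) (r : W -> H ⊗ W) (i : V -> W)
    (K : H -> W -> U) v : bil K ->
  r (i v) = \sw_(x, v0 <- coact v) x ⊗ i v0 ->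
  \sw_(x, w <- r (i v)) K x w = \sw_(x, v0 <- coact v) K x (i v0).
Proof. by move=> KL ->; rewrite sw_sw_tens. Qed.

Lemma sw_colin V W (i : V -> W) (U : lmodType k) (K : H -> W -> U) v :
  colin i -> bil K ->
  \sw_(x, u <- coact (i v)) K x u = \sw_(x, v0 <- coact v) K x (i v0).
Proof. by move=> [_ iE] KL; apply: sw_intertwiner. Qed.

Lemma colin2_comp V W X Y (i : X -> Y) (f : V -> W -> X) :
  colin i -> colin2 f -> colin2 (fun v w => i (f v w)).
Proof.
move=> iC fC; split; first by apply/bilP; linear.
by move=> v w; rewrite iC.2 (sw_colin2 v w fC) //; linear.
Qed.

Lemma braid_colin V W V' W' (i : V -> V') (j : W -> W') (U : lmodType k)
    (f : V' -> W' -> U) v w : colin i -> colin j -> bil f ->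
  braid f (i v) (j w) = braid (fun v w => f (i v) (j w)) v w.
Proof.
move=> iL jL fL; rewrite /braid sw_colin //; last by linear.
by apply: eq_tlift => v1 v0; rewrite sw_colin //; linear.
Qed.

Lemma braid_colin2l X Z W Y (U : lmodType k) (f : X -> Z -> W)
    (F : W -> Y -> U) x z y : colin2 f -> bil F ->
  braid F (f x z) y
  = braid (fun z y => braid (fun x y => F (f x z) y) x y) z y.
Proof.
move=> fL FL; rewrite /braid sw_colin2 //; last by linear.
by apply: (braid_mull (T := fun x z y => F (f x z) y)); linear.
Qed.

Lemma braid_colin2r X Z W Y (U : lmodType k) (f : X -> Z -> W)
    (F : Y -> W -> U) x z y : colin2 f -> bil F ->
  braid F y (f x z)
  = braid (fun y x => braid (fun y z => F y (f x z)) y z) y x.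
Proof.
move=> fL FL; rewrite -(braid_mulr (T := fun y x z => F y (f x z))); [|linear..].
by apply: eq_tlift => y1 y0; rewrite sw_colin2 //; linear.
Qed.

(** Moving y past f(x, z) means moving it past x and past z; doing this after an
exchange of x and y undoes the exchange with x, and only z is left. *)
Lemma braid_cancelr X Y Z W (U : lmodType k) (f : X -> Z -> W)
    (G : W -> Y -> U) x y z : colin2 f -> bil G ->
  braid (fun x y => braid (fun y w => G w y) y (f x z)) x y
  = braid (fun y z => G (f x z) y) y z.
Proof.
move=> fL GL; pose P x y := braid (fun y z => G (f x z) y) y z.
rewrite -[RHS]/(P x y) -[RHS]braidK; last by rewrite /P /braid; linear.
by apply: eq_braid => x' y'; rewrite braid_colin2r //; linear.
Qed.

(** The mirror image of [braid_cancelr]: the exchange with z is undone. *)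
Lemma braid_cancell X Y Z W (U : lmodType k) (f : X -> Z -> W)
    (G : Y -> W -> U) x y z : colin2 f -> bil G ->
  braid (fun y z => braid (fun w y => G y w) (f x z) y) y z
  = braid (fun x y => G y (f x z)) x y.
Proof.
move=> fL GL; pose P y z := braid (fun x y => G y (f x z)) x y.
rewrite -[RHS]/(P y z) -[RHS]braidK; last by rewrite /P /braid; linear.
by apply: eq_braid => x' y'; rewrite braid_colin2l //; linear.
Qed.

(** The symmetry is colinear: the coactions of the two sides are related by
(CT1). *)
Lemma colin2_braid V W X (f : W -> V -> X) :
  colin2 f -> colin2 (fun v w => - braid (fun v w => f w v) v w).
Proof.
move=> fC; have fL := bil_colin2 fC.
split; first by apply/bilP; linear.
move=> v w.
rewrite (linN (@coact_lin X)) (lin_braid (g := @coact X)); last by linear.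
transitivity (- \sw_(v1, v0 <- coact v) \sw_(w1, w0 <- coact w)
    \sw_(v2, v00 <- coact v0) \sw_(w2, w00 <- coact w0)
    (beta v1 w1 *: ((w2 * v2) ⊗ f w00 v00))).
  congr (- _); apply: eq_tlift => v1 v0; apply: eq_tlift => w1 w0.
  rewrite fC.2 tlift_exchange scale_tlift; apply: eq_tlift => *.
  by rewrite scale_tlift.
rewrite (coact_iter2 (K := fun x y x' y' v w =>
  beta x y *: ((y' * x') ⊗ f w v))); [|linear..].
transitivity (- \sw_(v1, v0 <- coact v) \sw_(w1, w0 <- coact w)
    \sw_(x, x' <- comul v1) \sw_(y, y' <- comul w1)
    (beta x' y' *: ((x * y) ⊗ f w0 v0))).
  congr (- _); apply: eq_tlift => v1 v0; apply: eq_tlift => w1 w0.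
  have gL : lin (fun h : H => h ⊗ f w0 v0) by linear.
  have := congr1 (fun h : H => h ⊗ f w0 v0) (CT1 ct v1 w1).
  rewrite !(lin_sw gL) => e.
  transitivity (\sw_(x, x' <- comul v1)
      ((\sw_(y, y' <- comul w1) beta x y *: (y' * x')) ⊗ f w0 v0)).
    apply: eq_tlift => x x'; rewrite (lin_sw gL).
    by apply: eq_tlift => y y'; rewrite (linZ gL).
  rewrite e; apply: eq_tlift => x x'; rewrite (lin_sw gL).
  by apply: eq_tlift => y y'; rewrite (linZ gL).
rewrite -(coact_iter2 (K := fun x y x' y' v w =>
  beta x' y' *: ((x * y) ⊗ f w v))); [|linear..].
have nL (U : lmodType k) : lin (fun u : U => - u) by linear.
rewrite (lin_sw (nL _)); apply: eq_tlift => v1 v0.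
rewrite (lin_sw (nL _)); apply: eq_tlift => w1 w0.
have gL : lin (fun u : X => (v1 * w1) ⊗ u) by linear.
by rewrite (linN gL) (lin_braid _ _ _ gL).
Qed.

(** * The Jacobi identity as a Leibniz rule *)

Definition antisymmetric_bracket V (br : V -> V -> V) :=
  forall x y, br x y = - braid (fun x y => br y x) x y.

Definition jacobiator V (br : V -> V -> V) x y z :=
  br (br x y) z
  + \sw_(x1, x0 <- coact x) \sw_(y1, y0 <- coact y) \sw_(z1, z0 <- coact z)
      (beta x1 (y1 * z1) *: br (br y0 z0) x0)
  + \sw_(x1, x0 <- coact x) \sw_(y1, y0 <- coact y) \sw_(z1, z0 <- coact z)
      (beta (x1 * y1) z1 *: br (br z0 x0) y0).

Definition leibniz V (br : V -> V -> V) x y z :=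
  br x (br y z) = br (br x y) z - braid (fun y z => br (br x z) y) y z.

Section Transport.
Variables (V W : comod) (brV : V -> V -> V) (brW : W -> W -> W) (i : V -> W).
Hypotheses (iC : colin i) (brL : bil brW).
Hypothesis brE : forall x y, brW (i x) (i y) = i (brV x y).

Lemma antisym_colin x y : antisymmetric_bracket brV ->
  brW (i x) (i y) = - braid (fun x y => brW y x) (i x) (i y).
Proof.
move=> brA; have iL := lin_colin iC.
rewrite (braid_colin (f := fun x y => brW y x)) //; last by linear.
rewrite brE brA (linN iL) (lin_braid _ _ _ iL); congr (- _).
by apply: eq_braid => *; rewrite brE.
Qed.

Lemma leibniz_colin x y z :
  leibniz brV x y z -> leibniz brW (i x) (i y) (i z).
Proof.
rewrite /leibniz !brE => ->; have iL := lin_colin iC.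
rewrite (braid_colin (f := fun y z => brW (brW (i x) z) y)) //; last by linear.
rewrite (linB iL) (lin_braid _ _ _ iL); congr (_ - _).
by apply: eq_braid => *; rewrite !brE.
Qed.

End Transport.

Section Leibniz.
Variables (V : comod) (br : V -> V -> V).
Hypotheses (brC : colin2 br) (brA : antisymmetric_bracket br).

(** By antisymmetry the second term of the Jacobi identity is -[x, [y, z]], as it
exchanges x with the whole bracket [y, z].  The third term exchanges z with x
and with y; antisymmetry absorbs the exchange with x. *)
Lemma leibniz_jacobi x y z : leibniz br x y z <-> jacobiator br x y z = 0.
Proof.
have brL := bil_colin2 brC.
rewrite /jacobiator (braid_mull (T := fun x y z => br (br z x) y)); last by linear.
set t := tlift _ _.
have -> : t = - br x (br y z).
  rewrite brA opprK /t /braid; apply: eq_tlift => x1 x0.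
  by rewrite (sw_colin2 y z brC) //; linear.
have -> : braid (fun y z => braid (fun x z => br (br z x) y) x z) y z
  = - braid (fun y z => br (br x z) y) y z.
  rewrite -braidN; apply: eq_braid => y' z'.
  have gL : lin (br^~ y') by linear.
  by rewrite [br x z']brA (linN gL) opprK (lin_braid _ _ _ gL).
rewrite /leibniz addrAC; split=> [->|/eqP]; first by rewrite subrr.
by rewrite subr_eq0 => /eqP.
Qed.

(** The rule that moves x into the bracket [y, z] is equivalent to the one that
moves z into [x, y]: rewriting [y, [x, z]] by antisymmetry turns one correction
term into the other. *)
Lemma leibniz_left x y z : leibniz br x y z <->
  br (br x y) z = br x (br y z) - braid (fun x y => br y (br x z)) x y.
Proof.
have brL := bil_colin2 brC.
have -> : braid (fun x y => br y (br x z)) x y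
  = - braid (fun y z => br (br x z) y) y z.
  rewrite -(braid_cancelr x y z brC brL) -braidN.
  by apply: eq_braid => x' y'; rewrite brA.
rewrite /leibniz opprK; split=> [->|->]; by rewrite ?subrK ?addrK.
Qed.

(** Both exchanges of arguments in the Leibniz rule are instances of this: an
identity whose left-hand side changes sign under the symmetry, and whose two
right-hand terms are permuted by it, holds for (x, y) if it holds for
(y, x). *)
Lemma braid_flip X Y (U : lmodType k) (p s : X -> Y -> U) (q t : Y -> X -> U) :
  bil s -> (forall x y, p x y = - braid (fun x y => q y x) x y) ->
  (forall y x, q y x = t y x - braid (fun y x => s x y) y x) ->
  forall x y, p x y = s x y - braid (fun x y => t y x) x y.
Proof.
move=> sL pE qE x y; rewrite pE (eq_braid _ _ (fun x y => qE y x)) braidB.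
by rewrite braidK // opprB.
Qed.

(* The maps i, j, l restrict the three arguments to subcomodules, because the
   rule will only be known for arguments in prescribed summands. *)
Section Swap.
Variables (X Y Z : comod) (i : X -> V) (j : Y -> V) (l : Z -> V).

Lemma leibniz_swap12 : colin i -> colin j ->
  (forall y x z, leibniz br (j y) (i x) (l z)) ->
  forall x y z, leibniz br (i x) (j y) (l z).
Proof.
move=> iC jC leib x y z; have brL := bil_colin2 brC.
apply/leibniz_left.
rewrite (braid_colin (f := fun x y => br y (br x (l z)))) //; last by linear.
move: x y; apply: (braid_flip (q := fun y x => br (br (j y) (i x)) (l z)))
  => [|x y|y x]; first by linear.
- have gL : lin (br^~ (l z)) by linear.
  rewrite [br (i x) _]brA (linN gL).
  rewrite (braid_colin (f := fun x y => br y x)) //; last by linear.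
  by rewrite (lin_braid _ _ _ gL).
- have /leibniz_left -> := leib y x z.
  by rewrite (braid_colin (f := fun y x => br x (br y (l z)))) //; linear.
Qed.

Lemma leibniz_swap23 : colin j -> colin l ->
  (forall x z y, leibniz br (i x) (l z) (j y)) ->
  forall x y z, leibniz br (i x) (j y) (l z).
Proof.
move=> jC lC leib x y z; have brL := bil_colin2 brC; rewrite /leibniz.
rewrite (braid_colin (f := fun y z => br (br (i x) z) y)) //; last by linear.
move: y z; apply: (braid_flip (q := fun z y => br (i x) (br (l z) (j y))))
  => [|y z|z y]; first by linear.
- have gL : lin (br (i x)) by linear.
  rewrite [br (j y) _]brA (linN gL).
  rewrite (braid_colin (f := fun x y => br y x)) //; last by linear.
  by rewrite (lin_braid _ _ _ gL).
- by rewrite leib (braid_colin (f := fun y z => br (br (i x) z) y)) //; linear.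
Qed.

End Swap.

End Leibniz.

(** * The direct sum comodule *)

Section DirectSum.
Variables A L : comod.

Definition dsum_inl (a : A) : A * L := (a, 0).
Definition dsum_inr (h : L) : A * L := (0, h).
Let rho := dsum_coact (@coact A) (@coact L).

Lemma lin_dsum_inl : lin dsum_inl.
Proof. by move=> c x y; rewrite /dsum_inl; congr (_, _); rewrite /= scaler0 addr0. Qed.

Lemma lin_dsum_inr : lin dsum_inr.
Proof. by move=> c x y; rewrite /dsum_inr; congr (_, _); rewrite /= scaler0 addr0. Qed.

Hint Resolve lin_dsum_inl lin_dsum_inr : linear.

Lemma dsum_split (v : A * L) : v = dsum_inl v.1 + dsum_inr v.2.
Proof. by case: v => a h; congr (_, _); rewrite /= ?addr0 ?add0r. Qed.

Lemma eq_lin_dsum (U : lmodType k) (f g : A * L -> U) : lin f -> lin g ->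
  (forall a, f (dsum_inl a) = g (dsum_inl a)) ->
  (forall h, f (dsum_inr h) = g (dsum_inr h)) ->
  forall v, f v = g v.
Proof.
by move=> fL gL eA eL v; rewrite (dsum_split v) (linD fL) (linD gL) eA eL.
Qed.

Lemma dsum_coactE v : rho v =
  \sw_(x, a0 <- coact v.1) x ⊗ dsum_inl a0
  + \sw_(x, h0 <- coact v.2) x ⊗ dsum_inr h0.
Proof. by []. Qed.

Lemma lin_dsum_coact : lin rho.
Proof.
have rL : lin (fun v : A * L =>
  \sw_(x, a0 <- coact v.1) x ⊗ dsum_inl a0
  + \sw_(x, h0 <- coact v.2) x ⊗ dsum_inr h0).
  by linear.
exact: rL.
Qed.
Hint Resolve lin_dsum_coact : linear.

Lemma dsum_coact_inl a : rho (dsum_inl a) = \sw_(x, a0 <- coact a) x ⊗ dsum_inl a0.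
Proof.
rewrite dsum_coactE.
rewrite (lin0 (f := fun h => \sw_(x, h0 <- coact h) x ⊗ dsum_inr h0)) ?addr0 //.
by linear.
Qed.

Lemma dsum_coact_inr h : rho (dsum_inr h) = \sw_(x, h0 <- coact h) x ⊗ dsum_inr h0.
Proof.
rewrite dsum_coactE.
rewrite (lin0 (f := fun h => \sw_(x, h0 <- coact h) x ⊗ dsum_inl h0)) ?add0r //.
by linear.
Qed.

(** A candidate coaction r satisfies the comodule axioms on the image of every
comodule that intertwines with it; the two summands span the direct sum. *)
Lemma comodule_axioms_intertwiner V (W : lmodType k) (r : W -> H ⊗ W)
    (i : V -> W) :
  lin r -> lin i ->
  (forall v, r (i v) = \sw_(x, v0 <- coact v) x ⊗ i v0) -> forall v,
  \sw_(x, w <- r (i v)) \sw_(x1, x2 <- comul x) x1 ⊗ (x2 ⊗ w)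
    = \sw_(x, w <- r (i v)) x ⊗ r w
  /\ \sw_(x, w <- r (i v)) counit x *: w = i v.
Proof.
move=> rL iL rE v; rewrite !(sw_intertwiner (r := r) (i := i)) //; [|linear..].
split; last exact: coact_counit_lin.
rewrite -coact_iter; last by linear.
apply: eq_tlift => x w; rewrite rE.
have gL : lin (fun u : H ⊗ W => x ⊗ u) by linear.
by rewrite (lin_sw gL).
Qed.

Lemma dsum_comodule : comodule rho.
Proof.
have hA := comodule_axioms_intertwiner lin_dsum_coact lin_dsum_inl dsum_coact_inl.
have hL := comodule_axioms_intertwiner lin_dsum_coact lin_dsum_inr dsum_coact_inr.
split; first exact: lin_dsum_coact.
- apply: eq_lin_dsum => [||a|h]; [linear..| |].
    by have [] := hA a.
  by have [] := hL h.
- apply: eq_lin_dsum => [||a|h]; [linear..| |].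
    by have [] := hA a.
  by have [] := hL h.
Qed.

Definition dsum := Comod dsum_comodule.

Lemma eq_bil_dsum (U : lmodType k)
    (f g : dsum -> dsum -> U) : bil f -> bil g ->
  (forall a b, f (dsum_inl a) (dsum_inl b) = g (dsum_inl a) (dsum_inl b)) ->
  (forall a h, f (dsum_inl a) (dsum_inr h) = g (dsum_inl a) (dsum_inr h)) ->
  (forall h a, f (dsum_inr h) (dsum_inl a) = g (dsum_inr h) (dsum_inl a)) ->
  (forall h h', f (dsum_inr h) (dsum_inr h') = g (dsum_inr h) (dsum_inr h')) ->
  forall v w, f v w = g v w.
Proof.
move=> [fl fr] [gl gr] eAA eAL eLA eLL v w.
by move: v; apply: eq_lin_dsum => // [a|h]; move: w; apply: eq_lin_dsum.
Qed.

Lemma colin_dsum_inl : @colin A dsum dsum_inl.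
Proof. by split; [apply: lin_dsum_inl | apply: dsum_coact_inl]. Qed.

Lemma colin_dsum_inr : @colin L dsum dsum_inr.
Proof. by split; [apply: lin_dsum_inr | apply: dsum_coact_inr]. Qed.

End DirectSum.

(** * The double cross sum *)

Section DoubleCrossSum.
Variables (A L : comod) (brA : A -> A -> A) (brL : L -> L -> L).
Variables (lact : L -> A -> A) (ract : L -> A -> L).
Hypothesis mp : matched_pair beta (@coact A) brA (@coact L) brL lact ract.

Let iA : A -> dsum A L := @dsum_inl A L.
Let iL : L -> dsum A L := @dsum_inr A L.

Let iAC : colin iA. Proof. exact: colin_dsum_inl. Qed.
Let iLC : colin iL. Proof. exact: colin_dsum_inr. Qed.
Let brAC : colin2 brA. Proof. exact: lie_bracket (mp_lieA mp). Qed.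
Let brLC : colin2 brL. Proof. exact: lie_bracket (mp_lieL mp). Qed.
Let lactC : colin2 lact. Proof. by case: (mp_left mp). Qed.
Let ractC : colin2 ract. Proof. by case: (mp_right mp). Qed.
Hint Resolve iAC iLC brAC brLC lactC ractC : linear.

(** The bracket of h and a in the double cross sum; the bracket of a and h is
then forced by antisymmetry. *)
Definition cross (h : L) (a : A) : dsum A L := iA (lact h a) + iL (ract h a).

Definition dcs : dsum A L -> dsum A L -> dsum A L :=
  dcs_bracket beta (@coact A) brA (@coact L) brL lact ract.

Lemma crossC : colin2 cross.
Proof.
split; first by apply/bilP; rewrite /cross; linear.
move=> h a; rewrite (linD (@coact_lin (dsum A L))) iAC.2 iLC.2.
rewrite (sw_colin2 h a lactC) ?(sw_colin2 h a ractC); [|linear..].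
rewrite tlift_add; apply: eq_tlift => h1 h0.
rewrite tlift_add; apply: eq_tlift => a1 a0.
have gL : lin (fun u : dsum A L => (h1 * a1) ⊗ u) by linear.
by rewrite (linD gL).
Qed.
Hint Resolve crossC : linear.

Lemma dcsE x y : dcs x y =
  iA (brA x.1 y.1) + cross x.2 y.1 - braid (fun a g => cross g a) x.1 y.2
  + iL (brL x.2 y.2).
Proof.
have e1 : (braid (fun a g => cross g a) x.1 y.2).1
    = braid (fun a g => lact g a) x.1 y.2.
  rewrite (lin_braid (g := fst)); last by linear.
  by apply: eq_braid => a g /=; rewrite addr0.
have e2 : (braid (fun a g => cross g a) x.1 y.2).2
    = braid (fun a g => ract g a) x.1 y.2.
  rewrite (lin_braid (g := snd)); last by linear.
  by apply: eq_braid => a g /=; rewrite add0r.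
case: x y e1 e2 => [a h] [b g] /= e1 e2.
congr (_, _) => /=.
  by rewrite e1 !addr0.
by rewrite e2 !add0r [RHS]addrC addrA.
Qed.

Lemma bil_dcs : bil dcs.
Proof.
have bL : bil (fun x y : A * L =>
  iA (brA x.1 y.1) + cross x.2 y.1 - braid (fun a g => cross g a) x.1 y.2
  + iL (brL x.2 y.2)) by linear.
have [bl br] := bL.
by split=> [y c x x'|x c y y']; rewrite !dcsE;
  [exact: (bl y c x x')|exact: (br x c y y')].
Qed.
Hint Resolve bil_dcs : linear.

Let brAL : bil brA. Proof. exact: bil_colin2 brAC. Qed.
Let brLL : bil brL. Proof. exact: bil_colin2 brLC. Qed.
Let crossL : bil cross. Proof. exact: bil_colin2 crossC. Qed.
Let crossTL : bil (fun a g => cross g a). Proof. by linear. Qed.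

Lemma dcs_AA a b : dcs (iA a) (iA b) = iA (brA a b).
Proof.
rewrite dcsE /= (bil0l _ crossL) (bil0r _ (bil_braid crossTL)) (bil0l _ brLL).
by rewrite (lin0 (lin_colin iLC)) subr0 !addr0.
Qed.

Lemma dcs_LL h g : dcs (iL h) (iL g) = iL (brL h g).
Proof.
rewrite dcsE /= (bil0r _ crossL) (bil0l _ (bil_braid crossTL)) (bil0l _ brAL).
by rewrite (lin0 (lin_colin iAC)) subr0 !add0r.
Qed.

Lemma dcs_LA h a : dcs (iL h) (iA a) = cross h a.
Proof.
rewrite dcsE /= (bil0r _ (bil_braid crossTL)) (bil0r _ brLL) (bil0l _ brAL).
by rewrite (lin0 (lin_colin iAC)) (lin0 (lin_colin iLC)) subr0 add0r addr0.
Qed.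

Lemma dcs_AL a h : dcs (iA a) (iL h) = - braid (fun a h => cross h a) a h.
Proof.
rewrite dcsE /= (bil0l _ crossL) (bil0l _ brLL) (bil0r _ brAL).
by rewrite (lin0 (lin_colin iAC)) (lin0 (lin_colin iLC)) !add0r addr0.
Qed.

Lemma coact_dcs_colin X Y (i : X -> dsum A L) (j : Y -> dsum A L)
    (f : X -> Y -> dsum A L) x y : colin i -> colin j -> colin2 f ->
  (forall x y, dcs (i x) (j y) = f x y) ->
  coact (dcs (i x) (j y)) = \sw_(x1, x0 <- coact (i x)) \sw_(y1, y0 <- coact (j y))
    (x1 * y1) ⊗ dcs x0 y0.
Proof.
move=> iC jC fC fE; rewrite fE fC.2 (sw_colin x iC); last by linear.
apply: eq_tlift => x1 x0; rewrite (sw_colin y jC); last by linear.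
by apply: eq_tlift => y1 y0; rewrite fE.
Qed.

Lemma colin2_dcs : colin2 dcs.
Proof.
split; first exact/bilP/bil_dcs.
have iAbr := colin2_comp iAC brAC.
have iLbr := colin2_comp iLC brLC.
have crossB := colin2_braid crossC.
apply: (eq_bil_dsum (f := fun v w => coact (dcs v w))) => [||a b|a h|h a|h g].
- by linear.
- by linear.
- exact: coact_dcs_colin iAbr dcs_AA.
- exact: coact_dcs_colin crossB dcs_AL.
- exact: coact_dcs_colin crossC dcs_LA.
- exact: coact_dcs_colin iLbr dcs_LL.
Qed.

Lemma antisym_dcs : antisymmetric_bracket dcs.
Proof.
apply: (eq_bil_dsum (g := fun x y => - braid (fun x y => dcs y x) x y))
  => [||a b|a h|h a|h g]; [by linear..| | | |].
- exact: (antisym_colin iAC bil_dcs dcs_AA _ _ (lie_antisym (mp_lieA mp))).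
- rewrite (braid_colin (f := fun x y => dcs y x)) //; last by linear.
  by rewrite dcs_AL; congr (- _); apply: eq_braid => *; rewrite dcs_LA.
- rewrite (braid_colin (f := fun x y => dcs y x)) //; last by linear.
  rewrite dcs_LA (eq_braid _ _ (fun h b => dcs_AL b h)) braidN opprK.
  by rewrite braidK.
- exact: (antisym_colin iLC bil_dcs dcs_LL _ _ (lie_antisym (mp_lieL mp))).
Qed.

Lemma leibniz_AAA a b c : leibniz dcs (iA a) (iA b) (iA c).
Proof.
apply: (leibniz_colin iAC bil_dcs dcs_AA).
apply/(leibniz_jacobi brAC (lie_antisym (mp_lieA mp))).
exact: lie_jacobi (mp_lieA mp) a b c.
Qed.

Lemma leibniz_LLL h g f : leibniz dcs (iL h) (iL g) (iL f).
Proof.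
apply: (leibniz_colin iLC bil_dcs dcs_LL).
apply/(leibniz_jacobi brLC (lie_antisym (mp_lieL mp))).
exact: lie_jacobi (mp_lieL mp) h g f.
Qed.

Lemma dcs_cross_A h a b : dcs (cross h a) (iA b)
  = iA (brA (lact h a) b + lact (ract h a) b) + iL (ract (ract h a) b).
Proof.
have gL : lin (dcs^~ (iA b)) by linear.
by rewrite (linD gL) dcs_AA dcs_LA (linD (lin_colin iAC)) addrA.
Qed.

(** The braided terms of (BB1) and of the bracket differ by one antisymmetry:
[a, h ▷ b] is turned into [h ▷ b, a], and the exchange of h and a cancels. *)
Lemma leibniz_LAA h a b : leibniz dcs (iL h) (iA a) (iA b).
Proof.
rewrite /leibniz dcs_AA !dcs_LA dcs_cross_A.
rewrite (braid_colin (f := fun y z => dcs (dcs (iL h) z) y)) //; last by linear.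
have iAL := lin_colin iAC; have iLL := lin_colin iLC.
rewrite (eq_braid (g := fun a b => iA (brA (lact h b) a + lact (ract h b) a)
  + iL (ract (ract h b) a))); last by move=> a' b'; rewrite dcs_LA dcs_cross_A.
rewrite braidD -(lin_braid _ _ _ iAL) -(lin_braid _ _ _ iLL) opprD addrACA.
rewrite -(linB iAL) -(linB iLL) /cross; congr (iA _ + iL _).
  rewrite (BB1 mp) -![tlift _ _]/(braid _ _ _).
  have -> : braid (fun h a => brA a (lact h b)) h a
    = - braid (fun a b => brA (lact h b) a) a b.
    rewrite -(braid_cancelr _ _ _ lactC brAL) -braidN; apply: eq_braid => h' a'.
    exact: (lie_antisym (mp_lieA mp)).
  by rewrite braidD opprD addrACA addrA addrAC.
by case: (mp_right mp).
Qed.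

(** The bracket of h ▷ a in A with g in L carries an exchange past h ▷ a.
Composed with the exchange of g and a it leaves only the exchange of h and g,
which is the one in the left module axiom and in (BB2). *)
Lemma leibniz_LLA h g a : leibniz dcs (iL h) (iL g) (iA a).
Proof.
rewrite /leibniz dcs_LL !dcs_LA.
rewrite (braid_colin (f := fun y z => dcs (dcs (iL h) z) y)) //; last by linear.
have iAL := lin_colin iAC; have iLL := lin_colin iLC.
have gL x : lin (dcs x) by linear.
have gR x : lin (dcs^~ x) by linear.
rewrite (linD (gL _)) dcs_LA dcs_LL.
rewrite (eq_braid (g := fun g a => iL (brL (ract h a) g)
    - braid (fun a g => cross g a) (lact h a) g)); last first.
  by move=> g' a'; rewrite dcs_LA (linD (gR _)) dcs_AL dcs_LL addrC.
rewrite braidB (braid_cancell (G := fun g a => cross g a) _ _ _ lactC crossL).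
rewrite -(lin_braid _ _ _ iLL) /cross.
rewrite braidD -(lin_braid _ _ _ iLL) -(lin_braid _ _ _ iAL).
rewrite opprB -!addrA -(linB iLL) -!(linD iLL) addrA addrACA.
rewrite -(linD iAL) -(linD iLL); congr (iA _ + iL _).
  by rewrite (mp_left mp).2 subrK.
by rewrite (BB2 mp) addrA subrK addrAC addrK addrC.
Qed.

Lemma leibniz_dcs x y z : leibniz dcs x y z.
Proof.
(* The three letters name the summands of the three arguments in order. *)
have ALA := leibniz_swap12 colin2_dcs antisym_dcs iAC iLC leibniz_LAA.
have AAL := leibniz_swap23 colin2_dcs antisym_dcs iAC iLC ALA.
have LAL := leibniz_swap23 colin2_dcs antisym_dcs iAC iLC leibniz_LLA.
have ALL := leibniz_swap12 colin2_dcs antisym_dcs iAC iLC LAL.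
rewrite /leibniz; move: y z; apply: eq_bil_dsum => [||b c|b l|g c|g l].
- by linear.
- by linear.
- move: x; apply: eq_lin_dsum => [||a|h]; [by rewrite /braid; linear..| |].
    exact: leibniz_AAA.
  exact: leibniz_LAA.
- move: x; apply: eq_lin_dsum => [||a|h]; [by rewrite /braid; linear..| |].
    exact: AAL.
  exact: LAL.
- move: x; apply: eq_lin_dsum => [||a|h]; [by rewrite /braid; linear..| |].
    exact: ALA.
  exact: leibniz_LLA.
- move: x; apply: eq_lin_dsum => [||a|h]; [by rewrite /braid; linear..| |].
    exact: ALL.
  exact: leibniz_LLL.
Qed.

Lemma dcs_lie_algebra : lie_algebra beta (@coact (dsum A L)) dcs.
Proof.
split.
- exact: coactP.
- exact: colin2_dcs.
- exact: antisym_dcs.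
- move=> x y z.
  exact/(leibniz_jacobi colin2_dcs antisym_dcs)/leibniz_dcs.
Qed.

End DoubleCrossSum.
End Braid.

Theorem theorem2p2 (k : fieldType) (H : hopfAlgebra k) (beta : H -> H -> k)
    (A L : lmodType k)
    (rhoA : A -> H ⊗ A) (brA : A -> A -> A)
    (rhoL : L -> H ⊗ L) (brL : L -> L -> L)
    (lact : L -> A -> A) (ract : L -> A -> L) :
  cotriangular beta -> commutative_hopf H -> cocommutative_hopf H ->
  matched_pair beta rhoA brA rhoL brL lact ract ->
  lie_algebra beta (dsum_coact rhoA rhoL)
    (dcs_bracket beta rhoA brA rhoL brL lact ract).
Proof.
move=> ct _ _ mp.
exact: (@dcs_lie_algebra k H beta ct (Comod (lie_comodule (mp_lieA mp)))
  (Comod (lie_comodule (mp_lieL mp))) brA brL lact ract mp).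
Qed.
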